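(* Let $G$ be a graph (not necessarily connected) with cover ideal $J(G)$ and chromatic number $\chi(G)$. Then for any positive integer $c$: (1) $J(G)^{(2r-2c)}\subset J(G)^r$ for every integer $r\ge c\,\chi(G)$. (2) $J(G)^{(2r-2c-1)}\subset J(G)^r$ for every integer $r\ge c\,\chi(G)+1$.
   Context: All graphs are finite and simple, with no isolated vertices. The cover ideal $J(G)$ of a graph $G$, over a field $\mathbb{K}$, is the ideal of $\mathbb{K}[x : x\in V(G)]$ generated by the monomials $\prod_{x\in\Gamma}x$, $\Gamma$ a vertex cover of $G$; equivalently $J(G)=\bigcap_{\{x,y\}\in E(G)}(x,y)$. For an ideal $I$ in a Noetherian ring $R$, $I^{(s)}=\bigcap_{P\in\mathrm{Ass}(I)}(I^sR_P\cap R)$ is the $s$-th symbolic power. *)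

(* Defs.v *)
From mathcomp Require Import all_boot all_order all_algebra.
From mathcomp Require Import boolp classical_sets.
From mathcomp Require Import mpoly.

Set Implicit Arguments.
Unset Strict Implicit.
Unset Printing Implicit Defensive.

Import GRing.Theory.
Local Open Scope classical_set_scope.
Local Open Scope ring_scope.

Record sgraph := SGraph {
  vertex :> finType;
  adj : rel vertex;
  adj_sym : ssrbool.symmetric adj;
  adj_irr : irreflexive adj }.

Definition no_isolated_vertex (G : sgraph) : Prop :=
  forall x : G, exists y : G, adj x y.

Definition vertex_cover (G : sgraph) (C : {set G}) : bool :=
  [forall x, forall y, adj x y ==> (x \in C) || (y \in C)].

Definition colorable (G : sgraph) (k : nat) : bool :=
  [exists f : {ffun G -> 'I_k},
     [forall x, forall y, adj x y ==> (f x != f y)]].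

Lemma colorable_ex (G : sgraph) : exists k, colorable G k.
Proof.
exists #|G|; apply/existsP; exists [ffun x => enum_rank x].
apply/forallP => x; apply/forallP => y; apply/implyP => xy.
rewrite !ffunE; apply/eqP => /enum_rank_inj exy.
by rewrite exy adj_irr in xy.
Qed.

Definition chromatic_number (G : sgraph) : nat := ex_minn (colorable_ex G).

(* Unlike [idealr_closed], the unit ideal is allowed. *)
Definition is_ideal (R : comNzRingType) (I : set R) : Prop :=
  I 0 /\ (forall a u v : R, I u -> I v -> I (a * u + v)).

Definition ideal_gen (R : comNzRingType) (A : set R) : set R :=
  smallest (@is_ideal R) A.

(* For s = 0 the only generator is the empty product 1, so I^0 = R. *)
Definition ideal_pow (R : comNzRingType) (I : set R) (s : nat) : set R :=
  ideal_gen [set p | exists2 f : 'I_s -> R,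
                       forall i, I (f i) & p = \prod_(i < s) f i].

Definition prime_ideal (R : comNzRingType) (P : set R) : Prop :=
  idealr_closed (mem P) /\ prime_idealr_closed (mem P).

(* Ass(I) means Ass(R/I): the primes of the form (I : f), i.e. the
   annihilators of the classes f + I. *)
Definition Ass (R : comNzRingType) (I : set R) : set (set R) :=
  [set P | prime_ideal P /\ exists f : R, P = [set g | I (g * f)]].

(* Since R is a domain, R_P is taken as a subring of its fraction field. *)
Definition localization (R : idomainType) (P : set R) : set {fraction R} :=
  [set z | exists a u : R, ~ P u /\ z = tofrac a / tofrac u].

(* The extension I R_P: finite R_P-linear combinations of elements of I. *)
Definition loc_ext (R : idomainType) (P I : set R) : set {fraction R} :=
  [set z | exists (n : nat) (w : 'I_n -> {fraction R}) (a : 'I_n -> R),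
     (forall i, localization P (w i) /\ I (a i)) /\
     z = \sum_(i < n) w i * tofrac (a i)].

Definition symbolic_pow (R : idomainType) (I : set R) (s : nat) : set R :=
  \bigcap_(P in Ass I) (@tofrac R @^-1` loc_ext P (ideal_pow I s)).

(* The variable attached to the vertex x is 'X_(enum_rank x). *)
Definition cover_ideal (K : fieldType) (G : sgraph) : set {mpoly K[#|G|]} :=
  ideal_gen [set p | exists2 C : {set G},
                       vertex_cover C & p = \prod_(x in C) 'X_(enum_rank x)].

Arguments cover_ideal K G _ : clear implicits.

(* Main.v *)
From HB Require Import structures.
Require Import Defs.
From mathcomp Require Import all_boot all_order all_algebra.
From mathcomp Require Import boolp classical_sets.
From mathcomp Require Import mpoly.
From mathcomp Require Import zify.

Set Implicit Arguments.
Unset Strict Implicit.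
Unset Printing Implicit Defensive.

Import GRing.Theory.

(** Let [J] be the cover ideal, [q] the chromatic number, and let [e] be [2c]
    in the first inclusion and [2c+1] in the second one, so that both concern
    the symbolic power of exponent [2r-e].

    The algebra reduces the inclusions to a statement on exponent vectors.
    For an edge [xy], the prime generated by the two variables of [x] and [y]
    is associated to [J] (lemma [edge_Ass]).  If [p] lies in the [s]-th symbolic
    power of [J], then some [u] outside of this prime satisfies that [u * p] lies
    in [J^s], hence has order at least [s] along the prime; as the order is a
    valuation and [u] has order 0, [p] itself has order at least [s].  So every
    exponent vector [a] of [p] satisfies [a x + a y >= s] for every edge [xy]
    ([symbolic_pow_order]).  Conversely a monomial lies in [J^r] as soon as its
    exponent vector dominates the sum of the indicators of [r] vertex covers
    ([cover_pow_mono]).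

    It remains to find, for [a x + a y >= 2r-e] on the edges, [r] vertex covers
    whose indicators have a sum at most [a] ([covers_below_exponent]).  Taking
    complements, one needs [r] independent sets such that each vertex [x] lies in
    at least [b x = r - a x] of them, where the integers [b x] and [b y] satisfy
    [b x + b y <= e] on the edges.  Fix a [q]-coloring and number the independent sets by [k < r], the [k]-th one
    having the color [k mod q] and the level [k / q]; as [r >= c * q], every color
    occurs at all levels below [c].
    - If [b x <= c], put [x] in the sets of its own color at the levels below
      [b x].
    - If [b x > c], put [x] in the sets of its own color at the levels below
      [e - b x], and in all the sets at the higher levels.
    The vertices with [b x > c] are pairwise non-adjacent, since
    [2 * (c + 1) > e], and a neighbor [y] of such a vertex only occurs at the
    levels below [b y <= e - b x]; so all the sets are independent.  Counting the
    occurrences of [x] uses [q >= 2], which holds because every vertex lies on an edge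
    ([level_count]). *)

(** * Ideals and localization *)

Section Ideals.
Local Open Scope ring_scope.
Local Open Scope classical_set_scope.
Variable R : comNzRingType.
Implicit Types (A I : set R).

Lemma ideal_gen_ideal A : is_ideal (ideal_gen A).
Proof.
split=> [|a u v uA vA] I [II AI]; first exact: II.1.
by apply: II.2; [exact: uA | exact: vA].
Qed.

Lemma ideal_gen_sub A : A `<=` ideal_gen A.
Proof. exact: sub_gen_smallest. Qed.

Lemma idealMl I a u : is_ideal I -> I u -> I (a * u).
Proof. by move=> II Iu; rewrite -[_ * _]addr0; apply: II.2 => //; case: II. Qed.

Lemma ideal_sum I (J : Type) (s : seq J) (P : pred J) (F : J -> R) :
  is_ideal I -> (forall j, P j -> I (F j)) -> I (\sum_(j <- s | P j) F j).
Proof.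
move=> II IF; apply: big_ind => //; first exact: II.1.
by move=> u v Iu Iv; rewrite -[u]mul1r; apply: II.2.
Qed.
End Ideals.

Section Localization.
Local Open Scope ring_scope.
Local Open Scope classical_set_scope.
Variables (R : idomainType) (P I : set R).

(** Clearing denominators: the product of the denominators of a linear combination
    is outside of [P] because [P] is prime. *)
Lemma loc_extP : prime_ideal P -> is_ideal I -> forall p,
  loc_ext P I (tofrac p) -> exists2 u, ~ P u & I (u * p).
Proof.
move=> [[P0 P1 _] PM] II p [k [w [a [wa E]]]].
pose Q (z : {fraction R}) := exists u b, [/\ ~ P u, I b & z * tofrac u = tofrac b].
have notPM u v : ~ P u -> ~ P v -> ~ P (u * v).
  by move=> Pu Pv Puv; have := PM u v; rewrite !in_setE => /(_ Puv) /orP[];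
     rewrite in_setE.
have : Q (tofrac p).
  rewrite E; apply: big_ind.
  - exists 1, 0; split; [by move/negP: P1; rewrite in_setE | exact: II.1 |].
    by rewrite mul0r tofrac0.
  - move=> z z' [u [b [Pu Ib zu]]] [u' [b' [Pu' Ib' zu']]].
    exists (u * u'), (u' * b + u * b'); split; [exact: notPM | | ].
      by apply: II.2 => //; apply: idealMl.
    rewrite tofracD !tofracM -zu -zu' mulrDl; congr (_ + _).
      by rewrite mulrA mulrC.
    by rewrite mulrCA.
  move=> i _; have [[b [u [Pu wE]]] Ia] := wa i.
  exists u, (b * a i); split=> //; first exact: idealMl.
  rewrite wE mulrAC divfK ?tofracM // tofrac_eq0; apply/eqP => u0.
  by apply: Pu; rewrite u0; move: P0; rewrite in_setE.
move=> [u [b [Pu Ib /eqP]]]; rewrite -tofracM tofrac_eq => /eqP pu.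
by exists u; rewrite // mulrC pu.
Qed.
End Localization.

(** * The order along a set of variables *)

Section Order.
Local Open Scope ring_scope.
Local Open Scope classical_set_scope.
Variables (n : nat) (R : idomainType) (A : {set 'I_n}).
Implicit Types (p u : {mpoly R[n]}) (m : 'X_{1..n}).

Definition partdeg m : nat := (\sum_(i in A) m i)%N.

(** This is the [s]-th power of the prime generated by the variables
    indexed by [A]. *)
Definition order_ge (s : nat) : set {mpoly R[n]} :=
  [set p | forall m, m \in msupp p -> (s <= partdeg m)%N].

(** The substitution multiplying the variables of [A] by a new variable [T].  It
    is the tool that makes the order along [A] a valuation: the coefficient of
    [T^k] is the component of partial degree [k], so the order becomes the
    [T]-adic one, over a domain of coefficients. *)
Definition dilation : {mpoly R[n]} -> {poly {mpoly R[n]}} :=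
  mmap (polyC \o @mpolyC n R) (fun i => ('X_i)%:P * 'X^(i \in A)).

HB.instance Definition _ := GRing.RMorphism.copy dilation
  (mmap (polyC \o @mpolyC n R) (fun i => ('X_i)%:P * 'X^(i \in A))).

Lemma dilationX m : dilation 'X_[m] = ('X_[m])%:P * 'X^(partdeg m).
Proof.
have -> : partdeg m = (\sum_i (i \in A) * m i)%N.
  by rewrite /partdeg big_mkcond; apply: eq_bigr => i _; case: (i \in A); rewrite ?mul1n.
rewrite /dilation mmapX /mmap1 [in RHS]mpolyXE_id rmorph_prod /=.
rewrite -prodrXr -big_split /=.
by apply: eq_bigr => i _; rewrite exprMn rmorphXn -exprM.
Qed.

Lemma coef_dilation p k m :
  ((dilation p)`_k)@_m = p@_m *+ (partdeg m == k).
Proof.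
rewrite [p in LHS]mpolyE [p in RHS]mpolyE raddf_sum coef_sum !raddf_sum /=.
rewrite -sumrMnl; apply: eq_bigr => m' _.
rewrite -mul_mpolyC rmorphM /= /dilation mmapC -/dilation dilationX /=.
rewrite mulrA -polyCM coefCM coefXn mulr_natr raddfMn /= mul_mpolyC mcoeffZ.
rewrite mcoeffX [k == _]eq_sym; have [->//|_] := eqVneq m' m.
by rewrite mulr0 !mul0rn.
Qed.

Lemma order_ge_coefP s p :
  order_ge s p <-> forall k, (k < s)%N -> (dilation p)`_k = 0.
Proof.
split=> [ps k ks|p0 m mp]; last first.
  rewrite leqNgt; apply/negP => /p0 /(congr1 (mcoeff m)).
  by rewrite coef_dilation eqxx mcoeff0 => /eqP; rewrite mcoeff_eq0 mp.
apply/mpolyP => m; rewrite coef_dilation mcoeff0.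
have [/ps sm|mp] := boolP (m \in msupp p).
  by rewrite (_ : partdeg m == k = false) //; apply/eqP; lia.
by rewrite memN_msupp_eq0 ?mul0rn.
Qed.

Lemma order_ge_factorP s p :
  order_ge s p <-> exists q, dilation p = q * 'X^s.
Proof.
rewrite order_ge_coefP; split=> [p0|[q ->] k ks]; last by rewrite coefMXn ks.
exists (drop_poly s (dilation p)).
rewrite -[LHS](poly_take_drop s) (_ : take_poly _ _ = 0) ?add0r //.
by apply/polyP => k; rewrite coef_take_poly coef0; case: ltnP => // /p0.
Qed.

Lemma order_ge_ideal s : is_ideal (order_ge s).
Proof.
split=> [|a u v]; first by move=> m; rewrite msupp0.
move=> /order_ge_factorP[q uq] /order_ge_factorP[q' vq]; apply/order_ge_factorP.
by exists (dilation a * q + q'); rewrite rmorphD rmorphM /= uq vq mulrDl mulrA.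
Qed.

Lemma order_ge_pow (I : set {mpoly R[n]}) s :
  I `<=` order_ge 1 -> ideal_pow I s `<=` order_ge s.
Proof.
move=> I1; apply: smallest_sub (order_ge_ideal s) _ => _ [g gI ->].
apply/order_ge_factorP.
have /choice[q gq] i : exists q, dilation (g i) = q * 'X.
  by have /order_ge_factorP := I1 _ (gI i).
exists (\prod_(i < s) q i); rewrite rmorph_prod /=.
under eq_bigr do rewrite gq.
by rewrite big_split /= prodr_const card_ord.
Qed.

(** The additivity of the order, in the only case needed here: the coefficient of
    degree [k] of a product whose first factor [U] has a nonzero constant term and
    whose second factor vanishes below degree [k] is [U`_0 * P`_k]. *)
Lemma order_ge_saturated s u p :
  ~ order_ge 1 u -> order_ge s (u * p) -> order_ge s p.
Proof.
rewrite !order_ge_coefP /= rmorphM /=; move: (dilation u) (dilation p) => U P.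
move=> U1 UP0 k; elim/ltn_ind: k => k IH ks.
have U0 : U`_0 != 0 by apply/eqP => U0; apply: U1; case.
have := UP0 k ks; rewrite coefM big_ord_recl subn0 big1 => [|j _].
  by rewrite addr0 => /eqP; rewrite mulf_eq0 (negPf U0) => /eqP.
have jk : (k - lift ord0 j < k)%N by rewrite lift0; have := ltn_ord j; lia.
by rewrite (IH _ jk (ltn_trans jk ks)) mulr0.
Qed.

(** Primality is [order_ge_saturated] for [s = 1]. *)
Lemma order_ge1_prime : prime_ideal (order_ge 1).
Proof.
split; [split|].
- by rewrite in_setE; case: (order_ge_ideal 1).
- apply/negP; rewrite in_setE => /(_ 0%MM); rewrite msupp1 mem_head => /(_ isT).
  by rewrite /partdeg big1 // => i _; rewrite mnm0E.
- move=> a u v; rewrite !in_setE; exact: (order_ge_ideal 1).2.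
move=> u v; rewrite in_setE => uv; apply/orP.
have [u1|u1] := pselect (order_ge 1 u); first by left; rewrite in_setE.
by right; rewrite in_setE; apply: order_ge_saturated uv.
Qed.
End Order.

(** * Covers below an exponent vector *)

Lemma two_colors (G : sgraph) q (x y : G) : adj x y -> colorable G q -> (1 < q)%N.
Proof.
move=> xy /existsP[f /forallP/(_ x)/forallP/(_ y)/implyP/(_ xy)].
case: q f => [|[|q]] f //; first by case: (f x).
by rewrite !ord1 eqxx.
Qed.

(** The number of independent sets that contain a vertex [x] with demand [b] and
    color [i].  For [b > c] and [d = e - b], there are [d] such sets below level
    [d] and [r - d * q] at the other levels, and
    [d + (r - d * q) >= b] follows from [r >= c * q + (e - 2c)] and [q >= 2] because
    [d + b = e], unless [b > e], when [d = 0] and [r >= b] suffices. *)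
Lemma level_count (q c e r i b d : nat) :
  (1 < q)%N -> (i < q)%N -> (2 * c <= e <= 2 * c + 1)%N ->
  (c * q + (e - 2 * c) <= r)%N -> (b <= r)%N ->
  d = (if b <= c then b else e - b)%N ->
  (b <= #|[set k : 'I_r | ((k %% q == i) && (k %/ q < d)) ||
                         ((c < b) && (d <= k %/ q))]|)%N.
Proof.
move=> q1 iq /andP[e1 e2] rge br dE.
have {}dE : (b <= c)%N /\ d = b \/ (c < b)%N /\ d = (e - b)%N.
  by rewrite dE; case: (leqP b c); [left | right].
have dle : (d <= c)%N by lia.
have db : (d <= b)%N by lia.
have d_bc : (d < b -> c < b)%N by lia.
have room : (d < b -> d * q + (b - d) <= r)%N.
  move=> d_lt_b; have [eb|eb] := leqP e b; first by rewrite (_ : d = 0)%N; lia.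
  have [p pq] : exists p, q = p.+2 by exists (q - 2)%N; lia.
  (* [t = c - d] makes the inequality a consequence of [t * p >= 0]. *)
  have [t [ct bt]] : exists t, (c = d + t)%N /\ (b = d + t + t + (e - 2 * c))%N.
    by exists (c - d)%N; lia.
  subst q; nia.
(* Enumerate the sets containing [x]: those of color [i] at the levels below
   [d], and then all indices from [d * q] on. *)
pose h l := (if l < d then i + l * q else d * q + (l - d))%N.
have hr (l : 'I_b) : (h l < r)%N.
  rewrite /h; case: (ltnP l d) => ld.
    have : ((l + 1) * q <= c * q)%N by apply: leq_mul => //; lia.
    rewrite mulnDl; lia.
  by have := ltn_ord l; lia.
have qd l : (l < d)%N -> ((i + l * q) %/ q = l)%N.
  by move=> _; rewrite addnC divnMDl ?divn_small ?addn0 //; lia.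
have h_inj : injective (fun l : 'I_b => Ordinal (hr l)).
  move=> l l' [] E; apply: val_inj => /=; move: E.
  have small (u : nat) : (u < d)%N -> (i + u * q < d * q)%N.
    move=> ud; have : ((u + 1) * q <= d * q)%N by apply: leq_mul => //; lia.
    rewrite mulnDl; lia.
  rewrite /h; case: (ltnP l d) => ld; case: (ltnP l' d) => ld' E.
  - by rewrite -(qd _ ld) -(qd _ ld') E.
  - by have := small _ ld; lia.
  - by have := small _ ld'; lia.
  - lia.
rewrite -[leqLHS]card_ord -(card_imset _ h_inj).
apply/subset_leq_card/fintype.subsetP => k /imsetP[l _ ->]; rewrite inE /= /h.
case: (ltnP l d) => ld.
  by rewrite qd // addnC modnMDl modn_small // eqxx ld.
apply/orP; right; rewrite d_bc ?leq_divRL //; have := ltn_ord l; lia.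
Qed.

(** The combinatorial core: the [k]-th cover is the complement of the [k]-th
    independent set described at the top of the file. *)
Lemma covers_below_exponent (G : sgraph) (q c e r : nat) (a : G -> nat) :
  (1 < q)%N -> colorable G q -> (2 * c <= e <= 2 * c + 1)%N ->
  (c * q + (e - 2 * c) <= r)%N ->
  (forall x y, adj x y -> (2 * r <= a x + a y + e)%N) ->
  exists C : 'I_r -> {set G},
    (forall k, vertex_cover (C k)) /\
    (forall x, (\sum_(k < r) (x \in C k) <= a x)%N).
Proof.
move=> q1 /existsP[f /forallP fP] ebnd rge aP.
pose b x := (r - a x)%N.
pose d x := (if b x <= c then b x else e - b x)%N.
pose C k := [set x | ~~ (((k %% q == f x) && (k %/ q < d x)) ||
                         ((c < b x) && (d x <= k %/ q)))]%N.
exists (fun k : 'I_r => C k); split => [k|x].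
  apply/forallP => x; apply/forallP => y; apply/implyP => xy.
  rewrite !inE -negb_and; apply/negP.
  have ab := aP _ _ xy.
  have dP z : (b z <= c)%N /\ d z = b z \/ (c < b z)%N /\ d z = (e - b z)%N.
    by rewrite /d; case: (leqP (b z) c); [left | right].
  have [dx dy] := (dP x, dP y).
  (* Only two vertices placed by their own color need the coloring; the other
     cases contradict [ab].  The truncation in [b] is harmless there because
     both demands are positive. *)
  move=> /andP[/orP[/andP[/eqP fx kx]|/andP[bx kx]]
               /orP[/andP[/eqP fy ky]|/andP[by_ ky]]]; last 3 first.
  - by rewrite /b in dx dy by_; lia.
  - by rewrite /b in dx dy bx; lia.
  - by rewrite /b in bx by_; lia.
  have /forallP/(_ y)/implyP/(_ xy)/eqP := fP x.
  by apply; apply: val_inj; rewrite /= -fx -fy.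
have bx : (b x <= #|[set k : 'I_r | x \notin C k]|)%N.
  apply: leq_trans (level_count q1 (ltn_ord (f x)) ebnd rge (leq_subr _ _) erefl) _.
  by apply/subset_leq_card/fintype.subsetP => k; rewrite !inE negbK.
have -> : (\sum_(k < r) (x \in C k) = #|[set k : 'I_r | x \in C k]|)%N.
  by rewrite -sum1dep_card [RHS]big_mkcond.
have := cardsC [set k : 'I_r | x \in C k]; rewrite card_ord.
rewrite (_ : ~: _ = [set k : 'I_r | x \notin C k]); last by apply/setP => k; rewrite !inE.
by rewrite /b in bx; lia.
Qed.

(** * Monomials of the cover ideal *)

Section Cover.
Local Open Scope ring_scope.
Local Open Scope classical_set_scope.
Variables (K : fieldType) (G : sgraph).
Implicit Types (C : {set G}) (m : 'X_{1..#|G|}) (p : {mpoly K[#|G|]}).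

Definition indicator_mnm C : 'X_{1..#|G|} := [multinom (enum_val i \in C : nat) | i < #|G|].

Lemma indicator_mnmE C x : indicator_mnm C (enum_rank x) = (x \in C).
Proof. by rewrite mnmE enum_rankK. Qed.

Lemma prod_vars C : \prod_(x in C) 'X_(enum_rank x) = 'X_[indicator_mnm C] :> {mpoly K[#|G|]}.
Proof.
rewrite mpolyXE_id (reindex (@enum_rank G)) /=; last exact: onW_bij (@enum_rank_bij G).
rewrite big_mkcond; apply: eq_bigr => x _.
by rewrite indicator_mnmE; case: (x \in C); rewrite ?expr1 ?expr0.
Qed.

Lemma mnm_leP m1 m2 :
  (forall x, m1 (enum_rank x) <= m2 (enum_rank x))%N -> (m1 <= m2)%MM.
Proof. by move=> le12; apply/mnm_lepP => i; rewrite -[i]enum_valK. Qed.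

Lemma mem_ideal_mono (I : set {mpoly K[#|G|]}) p : is_ideal I ->
  (forall m, m \in msupp p -> I 'X_[m]) -> I p.
Proof.
move=> II Im; rewrite [p]mpolyE big_seq; apply: ideal_sum => // m /Im XI.
by rewrite -mul_mpolyC; apply: idealMl.
Qed.

Lemma cover_ideal_mono C m :
  vertex_cover C -> (indicator_mnm C <= m)%MM -> cover_ideal K G 'X_[m].
Proof.
move=> Cc /submK <-; rewrite mpolyXD; apply: (idealMl _ (ideal_gen_ideal _)).
by apply: ideal_gen_sub; exists C; rewrite // prod_vars.
Qed.

Lemma cover_pow_mono r (C : 'I_r -> {set G}) m :
  (forall k, vertex_cover (C k)) ->
  (forall x, \sum_(k < r) (x \in C k) <= m (enum_rank x))%N ->
  ideal_pow (cover_ideal K G) r 'X_[m].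
Proof.
move=> Cc Cm.
have le_m : (\sum_(k < r) indicator_mnm (C k) <= m)%MM.
  apply: mnm_leP => x; rewrite mnm_sumE; apply: leq_trans (Cm x).
  by apply: leq_sum => k _; rewrite indicator_mnmE.
rewrite -(submK le_m) mpolyXD; apply: (idealMl _ (ideal_gen_ideal _)).
apply: ideal_gen_sub; exists (fun k => 'X_[indicator_mnm (C k)]); last first.
  by rewrite (big_morph _ (@mpolyXD _ _) (@mpolyX0 _ _)).
by move=> k; apply: (cover_ideal_mono (Cc k)); apply: mnm_leP.
Qed.

(** * The prime of an edge *)

Section Edge.
Variables (x y : G).
Hypothesis xy : adj x y.

Definition ends : {set 'I_#|G|} := [set enum_rank x; enum_rank y]%SET.

Lemma partdeg_ends m : partdeg ends m = (m (enum_rank x) + m (enum_rank y))%N.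
Proof.
rewrite /partdeg big_setU1 ?big_set1 //= inE.
by apply/eqP => /enum_rank_inj exy; have := xy; rewrite exy adj_irr.
Qed.

Lemma cover_ideal_order1 : cover_ideal K G `<=` order_ge ends 1.
Proof.
rewrite /cover_ideal; apply: smallest_sub; first exact: order_ge_ideal.
move=> _ [C Cc ->] m.
rewrite prod_vars msuppX inE => /eqP ->.
rewrite partdeg_ends !indicator_mnmE.
by have /forallP/(_ x)/forallP/(_ y)/implyP/(_ xy) := Cc; do 2!case: (_ \in C).
Qed.

Lemma cover_setC1 z : vertex_cover (~: [set z : G])%SET.
Proof.
apply/forallP => u; apply/forallP => v; apply/implyP => uv; rewrite !inE.
by case: eqVneq => // uz; case: eqVneq => // vz; rewrite uz vz adj_irr in uv.
Qed.

(** The prime of the edge [xy] is the annihilator modulo [J] of the product [w] of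
    all the other variables.  Indeed the variable of [x] times [w] is the monomial
    of the cover [~: [set y]], and symmetrically; conversely [J] is contained in
    the prime, which does not contain [w]. *)
Lemma edge_Ass : Ass (cover_ideal K G) (order_ge ends 1).
Proof.
split; first exact: order_ge1_prime.
pose k := indicator_mnm (~: [set x; y])%SET; exists 'X_[k].
apply/seteqP; split=> [p p1|p] /=.
  rewrite [p]mpolyE mulr_suml big_seq; apply: (@ideal_sum _ _ _ _ _ _ (ideal_gen_ideal _)).
  move=> m /p1; rewrite partdeg_ends => mxy.
  rewrite -mul_mpolyC -mulrA -mpolyXD; apply: (idealMl _ (ideal_gen_ideal _)).
  (* The cover omits the endpoint that does not occur in [m], if there is one. *)
  have [z zcov] : exists z, (indicator_mnm (~: [set z])%SET <= m + k)%MM.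
    have [mx0|mx] := posnP (m (enum_rank x)); [exists x; rewrite mx0 in mxy|exists y];
      apply: mnm_leP => z; rewrite mnmDE !indicator_mnmE !inE;
      have [?|_] := eqVneq z x; have [?|_] := eqVneq z y => //=;
      try subst z; rewrite ?addn0 ?addn1 //.
  exact: cover_ideal_mono (cover_setC1 z) zcov.
rewrite mulrC => /cover_ideal_order1; apply: order_ge_saturated => /(_ k).
by rewrite msuppX inE eqxx partdeg_ends !indicator_mnmE !inE !eqxx orbT => /(_ isT).
Qed.

Lemma symbolic_pow_order s :
  symbolic_pow (cover_ideal K G) s `<=` order_ge ends s.
Proof.
move=> p /(_ _ edge_Ass) /loc_extP [||u u1 up].
- exact: order_ge1_prime.
- exact: ideal_gen_ideal.
by apply: order_ge_saturated u1 _; apply: order_ge_pow up; exact: cover_ideal_order1.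
Qed.
End Edge.

(** Both parts of the theorem at once: [e] is [2c] or [2c+1], and the condition
    [2r <= s + e] bounds the symbolic exponent [s] from below by [2r - e]. *)
Lemma symbolic_sub_ordinary (c e r s : nat) : no_isolated_vertex G ->
  (2 * c <= e <= 2 * c + 1)%N ->
  (c * chromatic_number G + (e - 2 * c) <= r)%N -> (2 * r <= s + e)%N ->
  symbolic_pow (cover_ideal K G) s `<=` ideal_pow (cover_ideal K G) r.
Proof.
move=> hG ebnd; rewrite /chromatic_number; case: ex_minnP => q col _ rge rs p psym.
apply: mem_ideal_mono => [|m mp]; first by apply: ideal_gen_ideal.
have ms x y : adj x y -> (s <= m (enum_rank x) + m (enum_rank y))%N.
  by move=> xy; rewrite -partdeg_ends //; apply: symbolic_pow_order psym _ mp.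
suff [C [Cc Cm]] : exists C : 'I_r -> {set G}, (forall k, vertex_cover (C k)) /\
    (forall x, \sum_(k < r) (x \in C k) <= m (enum_rank x))%N.
  exact: cover_pow_mono Cc Cm.
(* Without vertices every set is a cover and there is nothing to bound. *)
have [x _|G0] := pickP (@predT G); last first.
  by exists (fun _ => [set: G]%SET); split=> [k|x]; [apply/forallP => x | ]; have := G0 x.
have [y xy] := hG x.
apply: (covers_below_exponent (two_colors xy col) col ebnd rge) => u v /ms; lia.
Qed.
End Cover.

Theorem proposition4p3 (K : fieldType) (G : sgraph)
    (hG : no_isolated_vertex G) (c : nat) (hc : (0 < c)%N) :
  (forall r : nat, (c * chromatic_number G <= r)%N ->
     (symbolic_pow (cover_ideal K G) (2 * r - 2 * c)%N
        `<=` ideal_pow (cover_ideal K G) r)%classic) /\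
  (forall r : nat, (c * chromatic_number G + 1 <= r)%N ->
     (symbolic_pow (cover_ideal K G) (2 * r - 2 * c - 1)%N
        `<=` ideal_pow (cover_ideal K G) r)%classic).
Proof.
split=> r rge.
  by apply: (symbolic_sub_ordinary (c := c) (e := 2 * c)) => //; lia.
by apply: (symbolic_sub_ordinary (c := c) (e := 2 * c + 1)) => //; lia.
Qed.
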